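(* Let $0\le k,r\le m$ and let $B\in\mathbb{X}_{k,\tau}$. Then the restricted weight of the corresponding codeword $c_B$ is $$\mathrm{w}_B(r,m)=\left|\mathbb{X}_r\right|-\frac1q\sum_{\epsilon}\sum_{\chi}Q^{\chi}_{r,\epsilon}(k,\tau),$$ where $\epsilon$ runs over all types of symmetric matrices of rank $r$ and $\chi$ runs over all $q$ characters of $(\mathbb{F}_q,+)$ (including the trivial one).
   Context: $m$ is a positive integer, $q$ is a power of an odd prime, $\mathbb{F}_q$ is the finite field with $q$ elements, and $\mathbb{X}$ is the space of $m\times m$ symmetric matrices over $\mathbb{F}_q$. For $0\le r\le m$, $\mathbb{X}_r=\{A\in\mathbb{X}:\operatorname{rank}(A)=r\}$ and, for $0\le t\le m$, $\mathbb{X}_{\le t}=\{A\in\mathbb{X}:\operatorname{rank}(A)\le t\}=\{A_1,\dots,A_N\}$ in a fixed order. The code $C_{symm}(t,m)\subseteq\mathbb{F}_q^N$ consists of the codewords $c_B=(\mathrm{Tr}(BA_1),\dots,\mathrm{Tr}(BA_N))$ for $B\in\mathbb{X}$. The restricted weight is $\mathrm{w}_B(r,m)=|\{A\in\mathbb{X}_r:\mathrm{Tr}(BA)\ne0\}|$. A symmetric matrix of odd rank has type $0$. A symmetric matrix of even rank $2s$ has type $1$ (hyperbolic) if the nondegenerate quadratic form it induces modulo its radical is hyperbolic (an orthogonal sum of $s$ hyperbolic planes), and type $-1$ (elliptic) otherwise; the zero matrix has type $1$. $\mathbb{X}_{r,\tau}$ is the set of $B\in\mathbb{X}$ of rank $r$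 and type $\tau$. For a character $\chi:\mathbb{F}_q\to\mathbb{C}$ of $(\mathbb{F}_q,+)$ define $$Q^{\chi}_{r,\epsilon}(s,\tau)=\sum_{C\in\mathbb{X}_{r,\epsilon}}\chi(\mathrm{Tr}(AC))\quad\text{for }A\in\mathbb{X}_{s,\tau};$$ this does not depend on the choice of $A\in\mathbb{X}_{s,\tau}$ (an empty sum is $0$). *)

(* Defs.v *)
From HB Require Import structures.
From mathcomp Require Import all_boot all_order all_algebra.
From mathcomp Require Import all_fingroup all_solvable all_field all_character.

Set Implicit Arguments.
Unset Strict Implicit.
Unset Printing Implicit Defensive.

Import GRing.Theory.
Local Open Scope ring_scope.

Section SymmetricMatrices.
Variables (F : finFieldType) (m : nat).

Definition symX : {set 'M[F]_m} := [set A : 'M[F]_m | A \is symmetricmx].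

Definition symX_rank (r : nat) : {set 'M[F]_m} := [set A in symX | \rank A == r].

Definition qform (A : 'M[F]_m) (u : 'rV[F]_m) : F := (u *m A *m u^T) 0 0.

(* [kermx A] spans the radical of the bilinear form of a symmetric A. The     *)
(* rows of P represent a family of s + s vectors of the quotient of F^m by    *)
(* the radical; this family spans the quotient, hence is a basis of it when   *)
(* \rank A = 2s. In its coordinates (x, y) the induced quadratic form is      *)
(* x_1 y_1 + ... + x_s y_s, the orthogonal sum of s hyperbolic planes.        *)
Definition hyperbolic (s : nat) (A : 'M[F]_m) : bool :=
  [exists P : 'M[F]_(s + s, m),
    row_full (col_mx P (kermx A)) &&
    [forall x : 'rV[F]_s, forall y : 'rV[F]_s,
      qform A (row_mx x y *m P) == \sum_(i < s) x 0 i * y 0 i]].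

Definition mxtype (A : 'M[F]_m) : int :=
  if odd (\rank A) then 0
  else if hyperbolic (\rank A)./2 A then 1 else -1.

Definition symX_rank_type (r : nat) (tau : int) : {set 'M[F]_m} :=
  [set A in symX_rank r | mxtype A == tau].

Definition types_of_rank (r : nat) : seq int :=
  undup [seq mxtype A | A in symX_rank r].

Definition restricted_weight (B : 'M[F]_m) (r : nat) : nat :=
  #|[set A in symX_rank r | \tr (B *m A) != 0]|.

(* The sum does not depend on the choice of A in the class (s, tau). The value *)
(* 0 for an empty class is a convention.                                       *)
Definition Qsum (chi : F -> algC) (r : nat) (eps : int) (s : nat) (tau : int) :
    algC :=
  if [pick A in symX_rank_type s tau] is Some A then
    \sum_(C in symX_rank_type r eps) chi (\tr (A *m C))
  else 0.

End SymmetricMatrices.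

(* As a [finGroupType], a [finFieldType] carries its additive group law, so the *)
(* characters of (F, +) are the irreducible characters of the abelian group    *)
(* [set: F]. The lemmas below check this against the elementary notion.        *)
Section AdditiveCharacters.
Variable F : finFieldType.

Definition additive_character (chi : F -> algC) : Prop :=
  chi 0 = 1 /\ forall x y, chi (x + y) = chi x * chi y.

Lemma irr_additive_character (i : Iirr [set: F]) : additive_character 'chi_i.
Proof.
have lin : 'chi_i \is a linear_char.
  apply/char_abelianP; apply/centsP => x _ y _; exact: addrC.
split; first exact: (lin_char1 lin).
by move=> x y; apply: (lin_charM lin); rewrite inE.
Qed.

Lemma additive_character_irr (chi : F -> algC) :
  additive_character chi -> exists! i : Iirr [set: F], chi =1 'chi_i.
Proof.
case=> chi0 chiD.
have rP : mx_repr [set: F] (fun x : F => (chi x)%:M : 'M[algC]_1).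
  split; first by rewrite -[1%g]/(0 : F) chi0.
  by move=> x y _ _; rewrite -scalar_mxM -chiD.
have chiE x : cfRepr (MxRepresentation rP) x = chi x.
  by rewrite cfunE inE mulr1n /= mxtrace_scalar.
have lin : cfRepr (MxRepresentation rP) \is a linear_char.
  by rewrite qualifE /= cfRepr_char cfRepr1 eqxx.
have /irrP [i Di] := lin_char_irr lin.
exists i; split=> [x|j chij]; first by rewrite -Di chiE.
by apply: irr_inj; rewrite -Di; apply/cfunP => x; rewrite chiE chij.
Qed.

Lemma card_additive_characters : #|Iirr [set: F]| = #|F|.
Proof.
rewrite card_ord NirrE -cardsT; apply/eqP; rewrite -card_classes_abelian.
by apply/centsP => x _ y _; exact: addrC.
Qed.

End AdditiveCharacters.

(* Main.v *)
Require Import Defs.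
From mathcomp Require Import all_boot all_order all_algebra.
From mathcomp Require Import all_fingroup all_solvable all_field all_character.
From mathcomp Require Import ring.

Set Implicit Arguments.
Unset Strict Implicit.
Unset Printing Implicit Defensive.

Import GRing.Theory.
Local Open Scope ring_scope.

(** The sum of all additive characters of [F_q] is the regular character, equal
    to [q] at [0] and to [0] elsewhere ([sum_additive_characters]). Hence, for a
    fixed [A] of rank [k] and type [tau], summing [chi (Tr (A C))] over all
    characters and all symmetric [C] of rank [r] gives [q] times the number of
    such [C] with [Tr (A C) = 0]. The restricted weight of [B] counts the
    complementary set, but for [B] in place of [A], so what remains is that this
    number depends only on the rank and the type.

    If [P A P^T = c B] with [P] invertible and [c] nonzero, then
    [Tr (A (P^T C P)) = c Tr (B C)], and [C |-> P^T C P] permutes the symmetric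
    matrices of rank [r]; so similar matrices have equal counts
    ([card_trace_kernel_similar]). It is therefore enough that two matrices of
    the same rank and type are similar ([same_type_similar]).

    A symmetric matrix of rank [k] is congruent to
    [diag (delta, 1, ..., 1, 0, ..., 0)] with [k] nonzero entries
    ([symmetric_normal_form]): it can be diagonalized, and any two nonzero
    diagonal entries [a, b] can be replaced by [a b, 1] because [a x^2 + b y^2]
    represents [1] over a finite field. Only the square class of [delta] matters,
    and there are two of them. When [k] is odd, scaling the matrix by [c]
    multiplies [delta] by [c] up to squares, so all matrices of rank [k] are
    similar. When [k = 2 s > 0], a change to hyperbolic coordinates exists exactly
    when [delta] lies in the square class of the determinant of the hyperbolic
    Gram matrix ([represents_square_class]), so the type determines the square
    class of [delta] and hence the congruence class. *)

(** * Squares in a finite field *)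

Section Squares.
Variable F : finFieldType.

Definition is_square (x : F) : Prop := exists y, x = y ^+ 2.

Lemma odd_card_two_neq0 : odd #|F| -> 2%:R != 0 :> F.
Proof.
move=> oddF; apply/eqP => two0.
have: (#[1%R : F]%g %| #|F|)%N by rewrite -cardsT order_dvdG ?inE.
have dvd2 : (#[1%R : F]%g %| 2)%N by rewrite order_dvdn FinRing.zmodXgE two0.
case/primeP: (isT : prime 2) => _ /(_ _ dvd2) /orP [/eqP o1|/eqP ->].
  have /eqP := o1; rewrite order_eq1 => /eqP e1.
  by have /eqP := oner_neq0 F.
by rewrite dvdn2 oddF.
Qed.

(** The squaring map is two-to-one away from [0], so the nonzero squares are
    at least half of the nonzero elements; together with [0] the squares are
    more than half of the field. *)
Lemma card_squares : (#|F| < #|[set x ^+ 2 | x : F]|.*2)%N.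
Proof.
set S := [set _ | _ in _].
have S0 : 0 \in S by apply/imsetP; exists 0; rewrite ?expr0n.
have -> : #|F| = (\sum_(s in S) #|[set x : F | x ^+ 2 == s]|)%N.
  rewrite -[LHS]sum1_card (partition_big (fun x : F => x ^+ 2) (mem S)) /=.
    by apply: eq_bigr => s _; rewrite -sum1_card; apply: eq_bigl => x; rewrite inE.
  by move=> x _; apply: imset_f.
rewrite (bigD1 0) //= (cardsD1 0 S) S0 doubleD -addn1 addnAC leq_add //.
  rewrite addn1 (_ : [set _ | _] = [set 0]) ?cards1 //.
  by apply/setP => x; rewrite !inE sqrf_eq0.
rewrite -muln2 -sum_nat_const.
rewrite (eq_bigl (mem (S :\ 0))) => [|x]; last by rewrite !inE andbC.
apply: leq_sum => s; rewrite !inE => /andP [_ /imsetP [y _ ->]].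
apply: leq_trans (_ : #|[set y; - y]| <= 2)%N; last by rewrite cards2; case: eqP.
by apply/subset_leq_card/subsetP => x; rewrite !inE eqf_sqr.
Qed.

(** Two sets of more than half the elements of [F] meet. *)
Lemma squares_pigeonhole (f g : F -> F) : injective f -> injective g ->
  exists x y, f (x ^+ 2) = g (y ^+ 2).
Proof.
move=> injf injg; set S := [set x ^+ 2 | x : F].
have: (#|f @: S :|: g @: S| <= #|F|)%N by apply: max_card.
have [/setP dis|[z]] := set_0Vmem (f @: S :&: g @: S).
  rewrite cardsU (_ : f @: S :&: g @: S = set0) ?cards0; last exact/setP.
  by rewrite subn0 (card_imset _ injf) (card_imset _ injg) addnn leqNgt card_squares.
rewrite inE => /andP [/imsetP [s /imsetP [x _ ->] ->] /imsetP [t]].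
by case/imsetP => y _ -> fg _; exists x, y.
Qed.

(** The sets [a x^2] and [1 - b y^2] must share a value. *)
Lemma sum_squares_eq1 (a b : F) : a != 0 -> b != 0 ->
  exists x y, a * x ^+ 2 + b * y ^+ 2 = 1.
Proof.
move=> a0 b0.
have [|y z|x [y e]] := @squares_pigeonhole (fun s => a * s) (fun s => 1 - b * s).
- exact: mulfI.
- by move/addrI/oppr_inj/(mulfI b0).
by exists x, y; rewrite e subrK.
Qed.

(** This holds because the nonzero squares have index at most two in the
    multiplicative group. *)
Lemma mul_same_square_class (a b : F) : a != 0 -> b != 0 ->
  (is_square a <-> is_square b) -> is_square (a * b).
Proof.
move=> a0 b0 ab.
have [/existsP [x /eqP ax]|nsqa] := boolP [exists x, a == x ^+ 2].
  have [|y ->] := ab.1; first by exists x.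
  by exists (x * y); rewrite ax exprMn.
have nsqb y : b != y ^+ 2.
  apply: contraNneq nsqa => by2; have [|x ->] := ab.2; first by exists y.
  by apply/existsP; exists x.
(* The multiples [a * S] of the squares meet [S] only in [0], so by counting *)
(* the two sets cover the field, and the nonsquare [b] lies in [a * S].      *)
set S := [set x ^+ 2 | x : F].
have S0 : 0 \in S by apply/imsetP; exists 0; rewrite ?expr0n.
set T := [set a * s | s in S].
have TS : T :&: S = [set 0].
  apply/setP => z; rewrite !inE; apply/andP/eqP => [[]|->]; last first.
    by split=> //; apply/imsetP; exists 0; rewrite ?mulr0.
  case/imsetP => s /imsetP [x _ ->] -> /imsetP [y _ e].
  have [->|x0] := eqVneq x 0; first by rewrite expr0n mulr0.
  case/existsP: nsqa; exists (y / x).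
  by rewrite exprMn -e exprVn mulfK ?expf_neq0.
have: T :|: S = setT.
  apply/eqP; rewrite eqEcard subsetT cardsT cardsU TS cards1.
  rewrite card_imset; last exact: mulfI.
  by rewrite addnn; have := card_squares; case: (_.*2) => // n; rewrite subn1.
move/setP/(_ b); rewrite !inE => /orP [|/imsetP [y _ /eqP]].
  case/imsetP => s /imsetP [y _ ->] ->.
  by exists (a * y); rewrite exprMn mulrA.
by rewrite (negPf (nsqb y)).
Qed.

End Squares.

(** * Congruence of matrices *)

Section Congruence.
Variable F : finFieldType.

Lemma symmetricmxE n (A : 'M[F]_n) : (A \is symmetricmx) = (A^T == A).
Proof. by rewrite is_hermitianmxE expr0 scale1r map_mx_id // eq_sym. Qed.

Definition congruent n (A B : 'M[F]_n) : Prop :=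
  exists2 P : 'M[F]_n, P \in unitmx & P *m A *m P^T = B.

Lemma congruent_refl n (A : 'M[F]_n) : congruent A A.
Proof. by exists 1%:M; rewrite ?unitmx1 // trmx1 mul1mx mulmx1. Qed.

Lemma congruent_trans n (A B C : 'M[F]_n) :
  congruent A B -> congruent B C -> congruent A C.
Proof.
case=> P uP <- [Q uQ <-]; exists (Q *m P); first by rewrite unitmx_mul uQ.
by rewrite trmx_mul !mulmxA.
Qed.

Lemma congruent_sym n (A B : 'M[F]_n) : congruent A B -> congruent B A.
Proof.
case=> P uP <-; exists (invmx P); first by rewrite unitmx_inv.
by rewrite !mulmxA mulVmx // mul1mx -mulmxA -trmx_mul mulVmx // trmx1 mulmx1.
Qed.

Lemma congruent_scale n c (A B : 'M[F]_n) :
  congruent A B -> congruent (c *: A) (c *: B).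
Proof. by case=> P uP <-; exists P; rewrite // -scalemxAr -scalemxAl. Qed.

Lemma congruent_trmx n (A B : 'M[F]_n) : congruent A B -> A^T = A -> B^T = B.
Proof. by case=> P _ <- symA; rewrite !trmx_mul trmxK symA mulmxA. Qed.

Lemma congruent_rank n (A B : 'M[F]_n) : congruent A B -> \rank A = \rank B.
Proof.
case=> P uP <-; rewrite mxrankMfree ?row_free_unit ?unitmx_tr //.
by rewrite -[RHS]mxrank_tr trmx_mul mxrankMfree ?mxrank_tr // row_free_unit unitmx_tr.
Qed.

Lemma congruent_block m n (A A' : 'M[F]_m) (B B' : 'M[F]_n) :
  congruent A A' -> congruent B B' ->
  congruent (block_mx A 0 0 B) (block_mx A' 0 0 B').
Proof.
case=> P uP <- [Q uQ <-]; exists (block_mx P 0 0 Q).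
  by rewrite unitmxE det_ublock unitrM -!unitmxE uP.
rewrite tr_block_mx !mulmx_block !trmx0.
by rewrite !(mul0mx, mulmx0, addr0, add0r).
Qed.

(** A symmetric bilinear form is determined by its quadratic form, because
    [2 u A v^T = q(u + v) - q(u) - q(v)]. *)
Lemma qform_eq0 n (A : 'M[F]_n) : 2%:R != 0 :> F -> A^T = A ->
  (forall u : 'rV[F]_n, (u *m A *m u^T) 0 0 = 0) -> A = 0.
Proof.
move=> two0 symA q0; apply/matrixP => i j.
pose b (u v : 'rV[F]_n) := (u *m A *m v^T) 0 0.
have bD u v : b (u + v) (u + v) = b u u + b v v + (b u v + b v u).
  rewrite /b linearD /= !(mulmxDl, mulmxDr) !mxE; ring.
have bC u v : b u v = b v u.
  by rewrite /b -[in LHS](trmxK (u *m _ *m _)) mxE !trmx_mul trmxK symA mulmxA.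
have: b (delta_mx 0 i) (delta_mx 0 j) *+ 2 = 0.
  have := bD (delta_mx 0 i) (delta_mx 0 j).
  by rewrite /b !q0 !add0r -/(b _ _) -/(b _ _) -bC mulr2n.
rewrite -mulr_natr => /eqP; rewrite mulf_eq0 (negPf two0) orbF => /eqP.
by rewrite /b -rowE trmx_delta -colE !mxE.
Qed.

(** * Diagonal forms *)

(** Indexing the entries by natural numbers lets the diagonal be shifted and
    split into blocks without casts between ordinal types. *)
Definition tdiag m k (d : nat -> F) : 'M[F]_m :=
  diag_mx (\row_(i < m) if (i < k)%N then d i else 0).

Lemma eq_tdiag m k d e : (forall i, (i < k)%N -> d i = e i) ->
  tdiag m k d = tdiag m k e.
Proof.
move=> de; congr diag_mx; apply/rowP => i; rewrite !mxE.
by case: ifP => // /de.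
Qed.

Lemma tdiag_block m n k d :
  tdiag (m + n) (m + k) d =
  block_mx (tdiag m m d) 0 0 (tdiag n k (fun i => d (m + i)%N)).
Proof.
rewrite /tdiag -diag_mx_row; congr diag_mx; apply/rowP => i.
rewrite mxE; case: (split_ordP i) => j ->.
  by rewrite row_mxEl mxE /= ltn_ord ltn_addr.
by rewrite row_mxEr mxE /= ltn_add2l.
Qed.

Lemma tdiag0 m d : tdiag m 0 d = 0.
Proof. by apply/matrixP => i j; rewrite !mxE ltn0 mul0rn. Qed.

Lemma tr_tdiag m k d : (tdiag m k d)^T = tdiag m k d.
Proof. exact: tr_diag_mx. Qed.

Lemma det_tdiag m d : \det (tdiag m m d) = \prod_(i < m) d i.
Proof. by rewrite det_diag; apply: eq_bigr => i _; rewrite mxE ltn_ord. Qed.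

Lemma tdiag_pid m k d : (k <= m)%N ->
  tdiag m k d = (pid_mx k : 'M_(k, m))^T *m tdiag k k d *m pid_mx k.
Proof.
move=> km; have [n Dm] : exists n, m = (k + n)%N.
  by exists (m - k)%N; rewrite subnKC.
rewrite {km}Dm.
have -> : tdiag (k + n) k d = block_mx (tdiag k k d) 0 0 0.
  by rewrite -(tdiag0 n (fun i => d (k + i)%N)) -tdiag_block addn0.
have -> : pid_mx k = row_mx 1%:M 0 :> 'M[F]_(k, k + n) by rewrite pid_mx_row.
rewrite tr_row_mx trmx1 trmx0 mul_col_mx mul1mx mul0mx mul_col_row.
by rewrite mulmx1 !(mulmx0, mul0mx).
Qed.

Lemma rank_tdiag m k d : (k <= m)%N -> (forall i, d i != 0) ->
  \rank (tdiag m k d) = k.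
Proof.
move=> km d0; rewrite tdiag_pid // mxrankMfree; last first.
  by rewrite /row_free rank_pid_mx.
rewrite mxrankMfree; first by rewrite mxrank_tr rank_pid_mx.
by rewrite row_free_unit unitmxE det_tdiag unitfE; apply/prodf_neq0.
Qed.

Lemma congruent_tdiag_sqr m k d e : (forall i, e i != 0) ->
  congruent (tdiag m k d) (tdiag m k (fun i => e i ^+ 2 * d i)).
Proof.
move=> e0; exists (tdiag m m e).
  by rewrite unitmxE det_tdiag unitfE; apply/prodf_neq0.
rewrite tr_tdiag /tdiag !mulmx_diag; congr diag_mx; apply/rowP => i.
rewrite !mxE ltn_ord; case: ifP => _; last by rewrite mulr0 mul0r.
by rewrite mulrAC expr2.
Qed.

(** Split off a vector that is not isotropic, together with its orthogonal
    complement, and repeat. *)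
Lemma diagonalize n (A : 'M[F]_n) : 2%:R != 0 :> F -> A^T = A ->
  exists k d, [/\ (k <= n)%N, forall i, d i != 0 & congruent A (tdiag n k d)].
Proof.
move=> two0; elim: n A => [|n IHn] A symA.
  exists 0, (fun=> 1); split=> //; first by move=> i; apply: oner_neq0.
  by rewrite [A]flatmx0 tdiag0; apply: congruent_refl.
have [->|A0] := eqVneq A 0.
  exists 0, (fun=> 1); split=> //; first by move=> i; apply: oner_neq0.
  by rewrite tdiag0; apply: congruent_refl.
have [u qu] : exists u : 'rV[F]_n.+1, (u *m A *m u^T) 0 0 != 0.
  apply/existsP; apply: contraNT A0 => /existsPn q0; apply/eqP.
  by apply: qform_eq0 => // u; apply/eqP; rewrite -[_ == _]negbK.
have rku : \rank u = 1%N.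
  rewrite rank_rV (_ : u != 0) //.
  by apply: contraNneq qu => ->; rewrite !mul0mx mxE.
(* The first row of the basis [Q] is proportional to [u].                    *)
pose Q := row_ebase u; pose A1 : 'M_(1 + n) := Q *m A *m Q^T.
have AA1 : congruent A A1 by exists Q; rewrite ?row_ebase_unit.
have symA1 := congruent_trmx AA1 symA.
have a0 : A1 0 0 != 0.
  apply: contraNneq qu => a0; rewrite -(mulmx_ebase u) rku -/Q.
  have -> : pid_mx 1 = delta_mx 0 0 :> 'rV[F]_n.+1.
    by apply/rowP => j; rewrite !mxE; case: j => [[|j] ?].
  have w0 : row 0 Q *m A *m (row 0 Q)^T = 0.
    have -> : row 0 Q *m A *m (row 0 Q)^T = row 0 (col 0 A1).
      by rewrite !rowE colE /A1 trmx_mul trmx_delta !mulmxA.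
    by apply/matrixP => i j; rewrite !ord1 mxE mxE a0 mxE.
  rewrite -(mulmxA (col_ebase u)) -rowE trmx_mul !mulmxA.
  rewrite -[X in X *m _]mulmxA -[X in X *m _]mulmxA (mulmxA (row 0 Q)) w0.
  by rewrite mulmx0 mul0mx mxE.
clearbody A1; set a := A1 0 0 in a0.
pose v : 'cV_n := dlsubmx A1.
have DA1 : A1 = block_mx a%:M v^T v (drsubmx A1).
  rewrite -{1}[A1]submxK; congr block_mx.
    by apply/matrixP => i j; rewrite !ord1 !mxE /= !lshift0.
  by rewrite /v trmx_dlsub symA1.
(* [C] is the Schur complement of the entry [a], that is the form on the     *)
(* orthogonal complement of the first basis vector.                          *)
pose C := drsubmx A1 - a^-1 *: (v *m v^T).
have A1C : congruent A1 (block_mx a%:M 0 0 C).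
  exists (block_mx 1%:M 0 (- a^-1 *: v) 1%:M).
    by rewrite unitmxE det_lblock !det1 mulr1 unitr1.
  rewrite DA1 tr_block_mx !mulmx_block !trmx1 !trmx0 linearZ /=.
  rewrite !(mul1mx, mulmx1, mul0mx, mulmx0, addr0).
  rewrite -!scalemxAl -!scalemxAr mul_mx_scalar mul_scalar_mx.
  rewrite !scaleNr !scalerA mulVf // !scale1r !addNr.
  by rewrite mul0mx scaler0 oppr0 add0r addrC.
have symC : C^T = C.
  by rewrite /C linearB linearZ /= trmx_mul trmxK trmx_drsub symA1.
have [k [d [kn d0 Cd]]] := IHn C symC.
exists k.+1, (fun i => if i is j.+1 then d j else a); split=> //.
  by case.
apply: congruent_trans AA1 _; apply: congruent_trans A1C _.
rewrite -[n.+1]/(1 + n)%N -[k.+1]/(1 + k)%N tdiag_block.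
apply: congruent_block => //.
rewrite (_ : tdiag _ _ _ = a%:M); first exact: congruent_refl.
by apply/matrixP => i j; rewrite !ord1 !mxE.
Qed.

(** The entry [delta] stands first, so that an entry prepended to the diagonal is
    next to it and the two can be merged by a change of two coordinates. *)
Definition nform m k (delta : F) : 'M[F]_m :=
  tdiag m k (fun i => if i is 0 then delta else 1).

Lemma det_nform k delta : (0 < k)%N -> \det (nform k k delta) = delta.
Proof.
case: k => // k _; rewrite det_tdiag big_ord_recl /= big1 ?mulr1 //.
Qed.

(** A binary form [a x^2 + b y^2] represents [1], and its determinant is the
    only other invariant. *)
Lemma congruent_binary (d : nat -> F) : d 0%N != 0 -> d 1%N != 0 ->
  congruent (tdiag 2 2 d) (nform 2 2 (d 0%N * d 1%N)).
Proof.
move=> d0 d1; have [x [y xy1]] := sum_squares_eq1 d0 d1.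
(* The second row of [P] represents [1]; the first one is orthogonal to it   *)
(* and makes the determinant of [P] equal to [-1].                           *)
pose P : 'M[F]_2 := \matrix_(i, j)
  if i == 0 then (if j == 0 then - (d 1%N * y) else d 0%N * x)
  else (if j == 0 then x else y).
have ord2 (i : 'I_2) : i = 0 \/ i = 1.
  by case: i => [[|[|i]] lti] //; [left | right]; apply: val_inj.
have E : P *m tdiag 2 2 d *m P^T = nform 2 2 (d 0%N * d 1%N).
  apply/matrixP => i j; rewrite !mxE !big_ord_recl big_ord0 !mxE.
  rewrite !big_ord_recl !big_ord0 !mxE /=.
  case: (ord2 i) => ->; case: (ord2 j) => -> /=; rewrite ?mulr0n ?mulr1n.
  - by rewrite -[RHS]mulr1 -xy1; ring.
  - by ring.
  - by ring.
  - by rewrite -xy1; ring.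
exists P => //; rewrite unitmxE unitfE.
have: \det (nform 2 2 (d 0%N * d 1%N)) != 0 by rewrite det_nform ?mulf_neq0.
by apply: contraNneq => P0; rewrite -E !det_mulmx P0 !mul0r.
Qed.

(** Move the product of all entries to the front, two entries at a time. *)
Lemma congruent_nform m k (d : nat -> F) : (k <= m)%N -> (forall i, d i != 0) ->
  congruent (tdiag m k d) (nform m k (\prod_(i < k) d i)).
Proof.
elim: m k d => [|m IHm] [|[|k]] d // km d0.
- by rewrite /nform !tdiag0; apply: congruent_refl.
- by rewrite /nform !tdiag0; apply: congruent_refl.
- rewrite (_ : tdiag _ _ _ = nform m.+1 1 (\prod_(i < 1) d i)).
    exact: congruent_refl.
  by apply: eq_tdiag => -[|i] //; rewrite big_ord1.
have := IHm k.+1 (fun i => d i.+1) km (fun i => d0 i.+1).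
set p := \prod_(i < _) _ => IH.
have p0 : p != 0 by apply/prodf_neq0.
have -> : \prod_(i < k.+2) d i = d 0%N * p by rewrite big_ord_recl.
pose e i := if i is i'.+1 then (if i' is 0 then p else 1) else d 0%N.
apply: (congruent_trans (B := tdiag m.+1 k.+2 e)).
  rewrite -[m.+1]/(1 + m)%N -[k.+2]/(1 + k.+1)%N !tdiag_block.
  apply: congruent_block => //.
  rewrite (@eq_tdiag 1 1 d e); first exact: congruent_refl.
  by case.
case: m km {IHm IH} => // m _.
rewrite /nform -[m.+2]/(2 + m)%N -[k.+2]/(2 + k)%N !(tdiag_block 2 m k).
apply: congruent_block; last exact: congruent_refl.
exact: (@congruent_binary e (d0 0%N) p0).
Qed.

Lemma nform_square_class m k (a b : F) : a != 0 -> b != 0 ->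
  is_square (a * b) -> congruent (nform m k a) (nform m k b).
Proof.
move=> a0 b0 [y ab].
pose e i : F := if i is 0%N then y / a else 1.
have -> : nform m k b =
    tdiag m k (fun i => e i ^+ 2 * (if i is 0%N then a else 1)).
  apply: eq_tdiag => -[|i] _ /=; last by rewrite expr1n mulr1.
  by rewrite exprMn -ab exprVn; field.
apply: congruent_tdiag_sqr => -[|i] /=; last exact: oner_neq0.
rewrite mulf_neq0 ?invr_eq0 //.
by apply: contra_neq (mulf_neq0 a0 b0) => y0; rewrite ab y0 expr0n.
Qed.

(** * Classification *)

(** Diagonalize, then merge all nonzero diagonal entries into the first one. *)
Lemma symmetric_normal_form n (A : 'M[F]_n) : 2%:R != 0 :> F -> A^T = A ->
  exists2 delta, delta != 0 & congruent A (nform n (\rank A) delta).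
Proof.
move=> two0 symA; have [k [d [kn d0 Ad]]] := diagonalize two0 symA.
have -> : \rank A = k by rewrite (congruent_rank Ad) rank_tdiag.
exists (\prod_(i < k) d i); first by apply/prodf_neq0.
exact: congruent_trans Ad (congruent_nform kn d0).
Qed.

(** A form of rank [k] restricts to a nondegenerate form [G] in [k] variables
    exactly when its nondegenerate part and [G] have the same discriminant up to
    squares: then these two have the same normal form, and conversely the
    coordinate change multiplies the determinant by a square. *)
Lemma represents_square_class m k (A : 'M[F]_m) (delta : F) (G : 'M[F]_k) :
  2%:R != 0 :> F -> (0 < k <= m)%N -> delta != 0 -> congruent A (nform m k delta) ->
  G^T = G -> \det G != 0 ->
  (exists P : 'M[F]_(k, m), P *m A *m P^T = G) <-> is_square (\det G * delta).
Proof.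
move=> two0 /andP [k0 km] delta0 /congruent_sym [R uR AR] symG G0.
have [mu mu0] := symmetric_normal_form two0 symG.
have -> : \rank G = k by rewrite mxrank_unit // unitmxE unitfE.
move=> Gmu; have [S uS SG] := congruent_sym Gmu.
have detG : \det G = (\det S) ^+ 2 * mu.
  by rewrite -SG !det_mulmx det_tr det_nform // mulrAC expr2.
rewrite /nform tdiag_pid // -/(nform k k delta) in AR.
set E : 'M_(k, m) := pid_mx k in AR.
have EE : E *m E^T = 1%:M by rewrite tr_pid_mx pid_mx_id // pid_mx_1.
split=> [[P PG]|sq].
  exists (\det (P *m R *m E^T) * delta).
  have -> : G = (P *m R *m E^T) *m nform k k delta *m (P *m R *m E^T)^T.
    by rewrite -PG -AR !trmx_mul trmxK !mulmxA.
  by rewrite !det_mulmx det_tr det_nform // ?det_mulmx; ring.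
have sq' : is_square (delta * mu).
  case: sq => y ey; exists (y / \det S).
  have S0 : \det S != 0 by rewrite -unitfE -unitmxE.
  by rewrite exprMn -ey detG exprVn; field.
have [T uT TN] :=
  congruent_trans (nform_square_class k k delta0 mu0 sq') (congruent_sym Gmu).
exists (T *m E *m invmx R); rewrite -AR.
rewrite !trmx_mul !mulmxA mulmxKV // -TN.
rewrite -[_ *m R^T *m _]mulmxA -trmx_mul mulVmx // trmx1 mulmx1.
by rewrite -(mulmxA T E) EE mulmx1 -(mulmxA _ E) EE mulmx1.
Qed.

(** The Gram matrix of the quadratic form [x_1 y_1 + ... + x_s y_s], whence the
    entries [1/2]. *)
Definition hyperbolic_gram s : 'M[F]_(s + s) :=
  block_mx 0 (2%:R^-1)%:M (2%:R^-1)%:M 0.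

Lemma tr_hyperbolic_gram s : (hyperbolic_gram s)^T = hyperbolic_gram s.
Proof. by rewrite /hyperbolic_gram tr_block_mx !trmx0 !tr_scalar_mx. Qed.

Lemma hyperbolic_gram_unit s : 2%:R != 0 :> F -> hyperbolic_gram s \in unitmx.
Proof.
move=> two0; pose H : 'M[F]_(s + s) := block_mx 0 2%:R%:M 2%:R%:M 0.
suff: hyperbolic_gram s *m H = 1%:M by case/mulmx1_unit.
rewrite /hyperbolic_gram mulmx_block !(mul0mx, mulmx0, add0r, addr0).
by rewrite -!scalar_mxM mulVf // -scalar_mx_block.
Qed.

Lemma qform_hyperbolic_gram s (x y : 'rV[F]_s) : 2%:R != 0 :> F ->
  qform (hyperbolic_gram s) (row_mx x y) = \sum_(i < s) x 0 i * y 0 i.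
Proof.
move=> two0; rewrite /qform /hyperbolic_gram mul_row_block tr_row_mx.
rewrite mul_row_col !(mulmx0, add0r, addr0) !mul_mx_scalar -!scalemxAl.
rewrite -scalerDr mxE mxE !mxE -big_split /= mulr_sumr.
by apply: eq_bigr => i _; rewrite !mxE; field.
Qed.

(** By polarization the hyperbolic coordinates amount to a matrix identity.
    Its solutions [P] automatically span modulo the radical, since a vector
    [u P] in the radical satisfies [u H = 0] for the invertible Gram matrix. *)
Lemma hyperbolicP m s (A : 'M[F]_m) : 2%:R != 0 :> F -> A^T = A ->
  \rank A = (s + s)%N ->
  reflect (exists P : 'M[F]_(s + s, m), P *m A *m P^T = hyperbolic_gram s)
    (hyperbolic s A).
Proof.
move=> two0 symA rkA.
have qP (P : 'M[F]_(s + s, m)) u : qform A (u *m P) = qform (P *m A *m P^T) u.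
  by rewrite /qform trmx_mul !mulmxA.
apply: (iffP existsP) => -[P].
  case/andP=> _ /forallP hyp; exists P; apply/eqP; rewrite -subr_eq0; apply/eqP.
  apply: qform_eq0 => // [|u].
    by rewrite linearB /= tr_hyperbolic_gram !trmx_mul trmxK symA mulmxA.
  rewrite mulmxBr mulmxBl mxE [X in _ + X]mxE -!/(qform _ _) -qP.
  rewrite -[u]hsubmxK qform_hyperbolic_gram //.
  by have /forallP /(_ (rsubmx u)) /eqP -> := hyp (lsubmx u); rewrite subrr.
move=> PA; exists P; apply/andP; split; last first.
  by do 2![apply/forallP=> ?]; rewrite qP PA qform_hyperbolic_gram.
have inj_PA n (u : 'M_(n, s + s)) : u *m P *m A = 0 -> u = 0.
  move=> uPA; apply: (can_inj (mulmxK (hyperbolic_gram_unit s two0))).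
  by rewrite -PA !mulmxA uPA !mul0mx.
have freeP : row_free P.
  rewrite /row_free eqn_leq rank_leq_row /=.
  rewrite -[leqLHS](mxrank_unit (hyperbolic_gram_unit s two0)) -PA.
  by rewrite -mulmxA mxrankM_maxl.
rewrite /row_full -addsmxE mxrank_disjoint_sum.
  by rewrite mxrank_ker rkA (eqP freeP) subnKC // -rkA rank_leq_row.
apply/eqP; rewrite -submx0; apply/rV_subP => v; rewrite sub_capmx.
by case/andP=> /submxP [u ->] /sub_kermxP /inj_PA ->; rewrite mul0mx sub0mx.
Qed.

(** Similarity in the sense of quadratic forms: isometry up to a scalar. *)
Definition similar_forms n (A B : 'M[F]_n) : Prop :=
  exists2 c, c != 0 & congruent A (c *: B).

(** In even rank the type determines the square class of the discriminant.
    In odd rank [k], scaling by [c] changes the discriminant by [c ^ k], hence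
    moves it to any square class. *)
Lemma same_type_similar m k tau (A B : 'M[F]_m) : 2%:R != 0 :> F ->
  A \in symX_rank_type F m k tau -> B \in symX_rank_type F m k tau ->
  similar_forms A B.
Proof.
move=> two0; rewrite !inE => /andP [/andP [symA rkA] typA].
case/andP=> /andP [symB rkB] typB.
rewrite symmetricmxE in symA; have {}symA := eqP symA.
rewrite symmetricmxE in symB; have {}symB := eqP symB.
have km : (k <= m)%N by rewrite -(eqP rkA) rank_leq_row.
have [a a0 Aa] := symmetric_normal_form two0 symA.
have [b b0 Bb] := symmetric_normal_form two0 symB.
rewrite (eqP rkA) in Aa; rewrite (eqP rkB) in Bb.
have [oddk|evenk] := boolP (odd k).
  have ba0 : b * a != 0 by rewrite mulf_neq0.
  (* The scalar [b a] takes the discriminant [b] to [(b a)^k b], whose product *)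
  (* with [a] is [(b a)^(k + 1)], a square because [k] is odd.                 *)
  exists (b * a) => //; apply: congruent_trans Aa _; apply: congruent_sym.
  apply: congruent_trans (congruent_scale (b * a) Bb) _.
  pose e i : F := b * a * (if i is 0%N then b else 1).
  have e0 i : e i != 0 by rewrite mulf_neq0 //; case: i => // i; apply: oner_neq0.
  have -> : (b * a) *: nform m k b = tdiag m k e.
    apply/matrixP => i j; rewrite !mxE mulrnAr; congr (_ *+ _).
    by case: ifP; rewrite ?mulr0.
  apply: congruent_trans (congruent_nform km e0) _.
  apply: nform_square_class => //; first by apply/prodf_neq0.
  have -> : \prod_(i < k) e i = (b * a) ^+ k * b.
    rewrite big_split /= prodr_const card_ord; congr (_ * _).
    by case: (k) oddk => // n _; rewrite big_ord_recl big1 ?mulr1.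
  exists ((b * a) ^+ k./2.+1).
  by rewrite -exprM muln2 doubleS -mulrA -exprSr -[in LHS](odd_double_half k) oddk.
exists 1; rewrite ?oner_neq0 // scale1r.
have [k0|k0] := posnP k.
  move: Aa Bb; rewrite k0 /nform !tdiag0 => Aa /congruent_sym.
  exact: congruent_trans.
apply: (congruent_trans Aa); apply: congruent_sym; apply: (congruent_trans Bb).
apply: nform_square_class => //.
have [s Dk] : exists s, k = (s + s)%N.
  by exists k./2; rewrite addnn -[LHS]odd_double_half (negPf evenk).
subst k; pose h := \det (hyperbolic_gram s).
have h0 : h != 0 by rewrite -unitfE -unitmxE hyperbolic_gram_unit.
have hypE (M : 'M[F]_m) d : M^T = M -> \rank M = (s + s)%N -> d != 0 ->
    congruent M (nform m (s + s) d) -> hyperbolic s M <-> is_square (h * d).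
  move=> symM rkM d0 Md.
  rewrite -(represents_square_class two0 _ d0 Md (tr_hyperbolic_gram s) h0).
    by split=> /(hyperbolicP two0 symM rkM).
  by rewrite k0.
have hypAB : hyperbolic s A = hyperbolic s B.
  move: typB; rewrite -(eqP typA) /mxtype (eqP rkA) (eqP rkB).
  rewrite addnn odd_double doubleK.
  by do 2![case: hyperbolic].
have [|||y sq] := @mul_same_square_class F (h * b) (h * a); rewrite ?mulf_neq0 //.
  rewrite -(hypE A a symA (eqP rkA) a0 Aa) -(hypE B b symB (eqP rkB) b0 Bb).
  by rewrite hypAB.
exists (y / h); rewrite exprMn -sq exprVn; by field.
Qed.
End Congruence.

(** * Counting *)

Section Counting.
Variables (F : finFieldType) (m r : nat).

Definition trace_kernel (A : 'M[F]_m) : {set 'M[F]_m} :=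
  [set C in symX_rank F m r | \tr (A *m C) == 0].

(** If [P A P^T = c B], then [C |-> P^T C P] permutes the symmetric matrices of
    rank [r] and pulls the linear form [Tr (A _)] back to [c Tr (B _)]. *)
Lemma card_trace_kernel_similar (A B : 'M[F]_m) :
  similar_forms A B -> #|trace_kernel A| = #|trace_kernel B|.
Proof.
case=> c c0 [P uP PA]; pose f (C : 'M[F]_m) := P^T *m C *m P.
have injf : injective f.
  move=> C D /(can_inj (mulmxK uP)); apply: (can_inj (mulKmx _)).
  by rewrite unitmx_tr.
have <- : f @^-1: trace_kernel A = trace_kernel B; last first.
  by rewrite on_card_preimset //; apply: onW_bij; apply: injF_bij.
apply/setP => C; rewrite !inE.
have -> : \tr (A *m f C) = c * \tr (B *m C).
  by rewrite /f !mulmxA mxtrace_mulC !mulmxA PA -scalemxAl mxtraceZ.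
have -> : \rank (f C) = \rank C.
  rewrite mxrankMfree ?row_free_unit // -mxrank_tr trmx_mul trmxK.
  by rewrite mxrankMfree ?mxrank_tr ?row_free_unit.
rewrite mulf_eq0 (negPf c0) /=; congr (_ && _ && _).
have fT : (f C)^T = f C^T by rewrite /f !trmx_mul trmxK mulmxA.
by rewrite !symmetricmxE fT (inj_eq injf).
Qed.

(** All characters of the abelian group [F] have degree one, so their sum is the
    regular character. *)
Lemma sum_additive_characters (x : F) :
  \sum_(i : Iirr [set: F]) 'chi_i x = #|F|%:R *+ (x == 0).
Proof.
rewrite -cardsT -(cfRegE [group of [set: F]]) cfReg_sum sum_cfunE.
apply: eq_bigr => i _; rewrite cfunE.
by have [-> _] := irr_additive_character i; rewrite mul1r.
Qed.

Lemma sum_over_types (f : 'M[F]_m -> algC) :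
  \sum_(eps <- types_of_rank F m r) \sum_(C in symX_rank_type F m r eps) f C =
  \sum_(C in symX_rank F m r) f C.
Proof.
rewrite (exchange_big_dep (mem (symX_rank F m r))) /=; last first.
  by move=> eps C _; rewrite inE => /andP [].
apply: eq_bigr => C XC.
rewrite (eq_bigl (pred1 (mxtype C))) => [|eps]; last first.
  by rewrite inE XC /= eq_sym.
rewrite -big_filter filter_pred1_uniq ?undup_uniq ?big_seq1 // mem_undup.
by apply/imageP; exists C.
Qed.

End Counting.

Theorem corollary3p2 (F : finFieldType) (m k r : nat) (tau : int) (B : 'M[F]_m)
    (hq : odd #|F|) (hm : (0 < m)%N) (hk : (k <= m)%N) (hr : (r <= m)%N)
    (hB : B \in symX_rank_type F m k tau) :
  (restricted_weight B r)%:R =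
    #|symX_rank F m r|%:R
    - #|F|%:R^-1 * \sum_(eps <- types_of_rank F m r)
                     \sum_(i : Iirr [set: F]) Qsum m 'chi_i r eps k tau :> algC.
Proof.
rewrite /Qsum; case: pickP => [A hA|/(_ B)]; last by rewrite hB.
have cardAB :=
  card_trace_kernel_similar r (same_type_similar (odd_card_two_neq0 hq) hA hB).
have -> : \sum_(eps <- types_of_rank F m r) \sum_(i : Iirr [set: F])
    \sum_(C in symX_rank_type F m r eps) 'chi_i (\tr (A *m C)) =
    #|F|%:R * #|trace_kernel r A|%:R.
  under eq_bigr do rewrite exchange_big /=.
  rewrite sum_over_types; under eq_bigr do rewrite sum_additive_characters.
  rewrite -sum1_card natr_sum mulr_sumr big_mkcond [RHS]big_mkcond /=.
  apply: eq_bigr => C _; rewrite [in RHS]inE; case: (C \in _) => //=.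
  by case: eqP; rewrite ?mulr1.
rewrite mulKf; last by rewrite Num.Theory.pnatr_eq0 -lt0n; apply/card_gt0P; exists 0.
rewrite cardAB; apply/eqP; rewrite eq_sym subr_eq -natrD Num.Theory.eqr_nat; apply/eqP.
rewrite -(cardsID [set C | \tr (B *m C) == 0] (symX_rank F m r)) addnC.
by congr (_ + _)%N; apply: eq_card => C; rewrite !inE // andbC.
Qed.
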